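(* The family of functions $\left(\mathcal{H}e^{s_1,\dots,s_r}\right)$, indexed by all $r\in\mathbb{N}$ (with $r=0$ allowed) and all $(s_1,\dots,s_r)\in(\mathbb{N}^* )^r$ with $s_1\geq 2$ when $r\geq 1$, is linearly independent over the field $\mathbb{C}(z)$ of complex rational functions.
   Context: For $r\geq 1$ and $(s_1,\dots,s_r)\in(\mathbb{N}^* )^r$ with $s_1\ge 2$, the Hurwitz multizeta function is the holomorphic function on $\mathbb{C}\setminus(-\mathbb{N})$ defined by $\mathcal{H}e^{s_1,\dots,s_r}(z)=\sum_{0<n_r<\cdots<n_1}\frac{1}{(n_1+z)^{s_1}\cdots(n_r+z)^{s_r}}$, where the $n_i$ are integers; the condition $s_1\ge2$ ensures convergence. For the empty sequence ($r=0$), $\mathcal{H}e^{\emptyset}$ is the constant function $1$. Here $\mathbb{N}=\{0,1,2,\dots\}$ and $\mathbb{N}^*=\{1,2,\dots\}$. Linear independence over $\mathbb{C}(z)$ means: if finitely many rational functions $F_{\mathbf{s}}\in\mathbb{C}(z)$ satisfy $\sum_{\mathbf{s}}F_{\mathbf{s}}\mathcal{H}e^{\mathbf{s}}=0$ as functions (where defined), then all $F_{\mathbf{s}}=0$. *)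

(* Defs.v *)
From HB Require Import structures.
From mathcomp Require Import all_boot all_order all_algebra generic_quotient fraction complex.
From mathcomp Require Import all_classical all_reals all_analysis.
Import Order.TTheory GRing.Theory Num.Theory numFieldNormedType.Exports.
Set Implicit Arguments.
Unset Strict Implicit.
Unset Printing Implicit Defensive.
Local Open Scope quotient_scope.
Local Open Scope ring_scope.

(* The exponent sequence is s = [:: s_1; ...; s_r] and the summation index is
   the tuple n = (n_1, ..., n_r); sortedness of n_1, ..., n_r, 0 for > is the
   chain n_1 > ... > n_r > 0.  The truncation is n_1 < N. *)
Definition He_trunc (K : numFieldType) (s : seq nat) (z : K) (N : nat) : K :=
  \sum_(n : (size s).-tuple 'I_N | sorted gtn (rcons (map val n) 0%N))
    \prod_(i < size s) (((tnth n i)%:R + z) ^+ nth 0%N s i)^-1.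

Definition He (K : numFieldType) (s : seq nat) (z : K) : K :=
  (lim (He_trunc s z N @[N --> \oo]))%classic.

Definition admissible (s : seq nat) : bool :=
  all (leq 1) s && (if s is s1 :: _ then (2 <= s1)%N else true).

Definition He_index := {s : seq nat | admissible s}.

Definition He_domain (K : numFieldType) : set K :=
  [set z | forall n : nat, z != - n%:R]%classic.

Section RationalFunctions.
Variable K : fieldType.
Implicit Types (F : {fraction {poly K}}) (z : K) (p q : {poly K}).

(* Reduced numerator and denominator: repr F alone need not be in lowest
   terms, so its denominator could vanish at points that are not poles of F. *)
Definition rf_gcd F : {poly K} := gcdp (frac (repr F)).1 (frac (repr F)).2.
Definition rf_num F : {poly K} := (frac (repr F)).1 %/ rf_gcd F.
Definition rf_den F : {poly K} := (frac (repr F)).2 %/ rf_gcd F.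

Definition rf_defined F z : bool := (rf_den F).[z] != 0.
Definition rf_eval F z : K := (rf_num F).[z] / (rf_den F).[z].

Lemma rf_den_neq0 F : rf_den F != 0.
Proof.
have d0 : (frac (repr F)).2 != 0 by exact: denom_ratioP.
by rewrite /rf_den dvdp_div_eq0 ?dvdp_gcdr.
Qed.

Lemma rf_coprime F : coprimep (rf_num F) (rf_den F).
Proof.
apply: coprimep_div_gcd; apply/orP; right; exact: denom_ratioP.
Qed.

Lemma rf_numden F : F = tofrac (rf_num F) / tofrac (rf_den F).
Proof.
have g0 : rf_gcd F != 0.
  by rewrite gcdp_eq0 negb_and (denom_ratioP (repr F)) orbT.
have FE : F = tofrac (frac (repr F)).1 / tofrac (frac (repr F)).2.
  have d0 : (frac (repr F)).2 != 0 by exact: denom_ratioP.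
  apply: (canRL (mulfK _)); first by rewrite tofrac_eq0.
  rewrite -{1}[F]reprK; set x := repr F in d0 *.
  have -> : \pi_{fraction {poly K}} x * tofrac (frac x).2 =
     FracField.mul (\pi_{fraction {poly K}} x) (tofrac (frac x).2) by [].
  unlock FracField.tofrac; rewrite -FracField.pi_mul; apply/eqmodP => /=.
  rewrite FracField.equivfE /FracField.mulf !numden_Ratio ?mulf_neq0 ?oner_eq0 //.
  by rewrite !mulr1 mulrC.
rewrite [LHS]FE.
have -> : (frac (repr F)).1 = rf_num F * rf_gcd F by rewrite divpK ?dvdp_gcdl.
have -> : (frac (repr F)).2 = rf_den F * rf_gcd F by rewrite divpK ?dvdp_gcdr.
by rewrite !tofracM -mulf_div divff ?tofrac_eq0 // mulr1.
Qed.

Lemma rf_cross p q : q != 0 -> let F := tofrac p / tofrac q in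
  p * rf_den F = rf_num F * q.
Proof.
move=> q0 F; have := rf_numden F; rewrite {1}/F => /eqP.
rewrite eqr_div ?tofrac_eq0 ?rf_den_neq0 // -!tofracM.
by rewrite tofrac_eq => /eqP.
Qed.

Lemma rf_definedP F z :
  reflect (exists p q, q.[z] != 0 /\ F = tofrac p / tofrac q) (rf_defined F z).
Proof.
apply: (iffP idP) => [Fz | [p [q [qz FE]]]].
  by exists (rf_num F), (rf_den F); split=> //; exact: rf_numden.
have q0 : q != 0 by apply: contraNneq qz => ->; rewrite horner0.
have := rf_cross p q0; rewrite -FE => H.
have : rf_den F %| q.
  by rewrite -(Gauss_dvdpr _ (_ : coprimep _ (rf_num F))) -?H ?dvdp_mull //
             coprimep_sym rf_coprime.
by move=> /dvdpP [r qE]; move: qz; rewrite qE hornerM mulf_eq0 negb_or => /andP[].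
Qed.

Lemma rf_evalE p q z : q.[z] != 0 -> rf_eval (tofrac p / tofrac q) z = p.[z] / q.[z].
Proof.
move=> qz; have q0 : q != 0 by apply: contraNneq qz => ->; rewrite horner0.
have Fz : rf_defined (tofrac p / tofrac q) z by apply/rf_definedP; exists p, q.
apply/eqP; rewrite eqr_div // -!hornerM rf_cross //.
Qed.

End RationalFunctions.

(* Linear independence over K(z) of a family of K-valued functions on D; a
   finitely supported family of coefficients is given by its values on a
   duplicate-free finite list J of indices. *)
Definition ratfun_lin_indep (K : fieldType) (I : eqType) (D : set K)
    (f : I -> K -> K) : Prop :=
  forall (J : seq I) (F : I -> {fraction {poly K}}), uniq J ->
    (forall z, D z -> (forall i, i \in J -> rf_defined (F i) z) ->
       \sum_(i <- J) rf_eval (F i) z * f i z = 0) ->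
    forall i, i \in J -> F i = 0.

(* Main.v *)
Require Import Defs.
From mathcomp Require Import all_boot all_order all_algebra fraction complex.
From mathcomp Require Import ring.
From mathcomp Require Import all_classical all_reals all_analysis.
Import Order.TTheory GRing.Theory Num.Theory numFieldNormedType.Exports.
Set Implicit Arguments.
Unset Strict Implicit.
Unset Printing Implicit Defensive.
Local Open Scope ring_scope.

(** Splitting off the smallest summation index gives
    [He^(s,k)(z) = He^(s,k)(z+1) + (z+1)^(-k) He^s(z+1)], and only this
    recurrence at the points [z = 1, 2, 3, ...] is needed: a rational function is
    determined by its values at the large integers.  Given a nontrivial relation
    with polynomial coefficients, let [D] be the coefficient of a longest index
    [s0] occurring in it.  Cross-multiplying the relation at [z-1], rewritten by
    the recurrence, with the relation at [z] cancels the [s0] term, so by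
    induction all the new coefficients vanish.  Hence the coefficients of the
    indices as long as [s0] are constant multiples of [D], and if [A] is the
    coefficient of the index [t] obtained by dropping the last entry of [s0],
    [G = A / D] satisfies [G(z) - G(z-1) = sum_k c_k z^(-k)] with some [c_k]
    nonzero and all [k >= 1].  The poles of [G] would have to propagate
    indefinitely in one direction, so [G] is a polynomial, which is absurd. *)

(** * Polynomials at large integers and under unit shifts *)

Lemma poly_eventually_neq0 (K : numFieldType) (p : {poly K}) : p != 0 ->
  exists N, forall n, (N <= n)%N -> p.[n%:R] != 0.
Proof.
have [m] := ubnP (size p); elim: m p => // m IH p lt_p p0.
have [[n /factor_theorem[q pE]] | noroot] :=
    pselect (exists n, root p n%:R); last first.
  by exists 0%N => n _; apply/negP => pn; apply: noroot; exists n.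
have q0 : q != 0 by apply: contraNneq p0 => q0; rewrite pE q0 mul0r.
have [|N hN] := IH q _ q0.
  by move: lt_p; rewrite pE size_Mmonic ?monicXsubC // size_XsubC addn2.
exists (maxn N n.+1) => k; rewrite geq_max => /andP[Nk nk].
rewrite pE hornerM mulf_neq0 ?hN // !hornerE subr_eq0 eqr_nat.
by rewrite gtn_eqF.
Qed.

Lemma poly_eventually0 (K : numFieldType) (p : {poly K}) (N : nat) :
  (forall n, (N <= n)%N -> p.[n%:R] = 0) -> p = 0.
Proof.
move=> p0; apply/eqP; apply: contraT => /poly_eventually_neq0[M pM].
by have := pM _ (leq_maxr N M); rewrite p0 ?leq_maxl ?eqxx.
Qed.

(** The quotient [p / q] is unchanged by the unit shift, so it takes a single value at all large
    integers and is therefore constant; leading coefficients identify the constant. *)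
Lemma shift_invariant_ratio (K : numFieldType) (p q : {poly K}) : q != 0 ->
  (p \Po ('X - 1)) * q = p * (q \Po ('X - 1)) ->
  p = (lead_coef p / lead_coef q) *: q.
Proof.
move=> q0 pq; have [N qN] := poly_eventually_neq0 q0.
have ratio n : (N <= n)%N -> p.[n%:R] / q.[n%:R] = p.[N%:R] / q.[N%:R].
  elim: n => [|n IH]; first by rewrite leqn0 => /eqP->.
  rewrite leq_eqVlt => /orP[/eqP<- //|Nn]; rewrite -IH //.
  have := congr1 (horner^~ n.+1%:R) pq; rewrite !hornerE !horner_comp !hornerE.
  have -> : n.+1%:R - 1 = n%:R :> K by rewrite -natr1 addrK.
  move=> e; apply/eqP; rewrite eqr_div ?qN ?(leq_trans Nn) //; last exact: leqW.
  by rewrite -e mulrC.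
pose c := p.[N%:R] / q.[N%:R].
have pE : p = c *: q.
  apply/eqP; rewrite -subr_eq0; apply/eqP/(@poly_eventually0 _ _ N) => n Nn.
  by rewrite !hornerE /c -(ratio n Nn) divfK ?qN ?subrr.
by rewrite {2}pE lead_coefZ mulfK ?lead_coef_eq0 // -pE.
Qed.

Lemma poly_root_unbounded (K : numFieldType) (p : {poly K}) (a e : K) :
  e != 0 -> (forall n, root p (a + n%:R * e)) -> p = 0.
Proof.
move=> e0 rt; have : p \Po (a%:P + e *: 'X) = 0.
  apply: (@poly_eventually0 _ _ 0) => n _.
  by rewrite horner_comp !hornerE mulrC; apply/eqP/rt.
move/eqP; rewrite comp_poly_eq0 => [/eqP //|].
rewrite addrC size_polyDl size_scale ?size_polyX //.
by rewrite size_polyC; case: eqP.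
Qed.

(* The poles of A / D are stable under a translation by -1 until 0 is met and
   under a translation by +1 until -1 is met, so there are none. *)
Lemma shift_difference_no_pole (K : numClosedFieldType) (A D c : {poly K})
    (M : nat) : coprimep D A -> D != 0 ->
  'X^M * (A * (D \Po ('X - 1)) - (A \Po ('X - 1)) * D) =
    c * (D * (D \Po ('X - 1))) ->
  size D = 1%N.
Proof.
move=> copDA D0 eqM; apply/eqP; apply: contraT => /closed_rootP[a ra].
have eq_at w : w ^+ M * (A.[w] * D.[w - 1] - A.[w - 1] * D.[w]) =
    c.[w] * (D.[w] * D.[w - 1]).
  by have := congr1 (horner^~ w) eqM; rewrite !hornerE !horner_comp !hornerE.
have down b : root D b -> b != 0 -> root D (b - 1).
  move=> rb b0; have := eq_at b; rewrite (rootP rb) !(mulr0, mul0r) subr0 => /eqP.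
  by rewrite !mulf_eq0 expf_eq0 (negPf b0) andbF (negPf (coprimep_root copDA rb)).
have up b : root D b -> b + 1 != 0 -> root D (b + 1).
  move=> rb b0; have := eq_at (b + 1); rewrite addrK (rootP rb) !(mulr0, mul0r).
  move/eqP; rewrite sub0r mulrN oppr_eq0 !mulf_eq0 expf_eq0 (negPf b0) andbF.
  by rewrite (negPf (coprimep_root copDA rb)).
have [[m aE] | a_nat] := pselect (exists m : nat, a = m%:R).
  have : D = 0; last by move/eqP; rewrite (negPf D0).
  apply: (@poly_root_unbounded _ _ a 1); rewrite ?oner_eq0 // => n.
  elim: n => [|n IH]; rewrite ?mul0r ?addr0 // -natr1 mulrDl mul1r addrA.
  by apply: up; rewrite // aE mulr1 -!natrD natr1 pnatr_eq0.
have : D = 0; last by move/eqP; rewrite (negPf D0).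
apply: (@poly_root_unbounded _ _ a (-1)); rewrite ?oppr_eq0 ?oner_eq0 // => n.
elim: n => [|n IH]; rewrite ?mul0r ?addr0 // -natr1 mulrDl mul1r addrA.
apply: down; rewrite // mulrN1 subr_eq0; apply/eqP => an.
by apply: a_nat; exists n.
Qed.

(** In lowest terms [A / D] has no pole, so its denominator is a constant and ['X^M] divides a
    nonzero scalar multiple of [c]; as [c] has degree below [M], only [c = 0] remains. *)
Lemma shift_difference_eq0 (K : numClosedFieldType) (A D c : {poly K})
    (M : nat) : D != 0 -> (size c <= M)%N ->
  'X^M * (A * (D \Po ('X - 1)) - (A \Po ('X - 1)) * D) =
    c * (D * (D \Po ('X - 1))) ->
  c = 0.
Proof.
move=> D0 szc.
pose g := gcdp D A.
have g0 : g != 0 by rewrite gcdp_eq0 negb_and D0.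
have AE : A = A %/ g * g by rewrite divpK ?dvdp_gcdr.
have DE : D = D %/ g * g by rewrite divpK ?dvdp_gcdl.
have cop : coprimep (D %/ g) (A %/ g) by rewrite coprimep_div_gcd ?D0.
have D'0 : D %/ g != 0 by apply: contraNneq D0 => e; rewrite DE e mul0r.
move: (A %/ g) (D %/ g) AE DE cop D'0 => A' D' -> -> cop D'0.
rewrite !comp_polyM => eqM.
have sg0 : g \Po ('X - 1) != 0 by rewrite comp_poly_eq0 ?size_XsubC.
have eqM' : 'X^M * (A' * (D' \Po ('X - 1)) - (A' \Po ('X - 1)) * D') =
    c * (D' * (D' \Po ('X - 1))).
  by apply: (mulIf (mulf_neq0 g0 sg0)); apply: etrans (etrans eqM _); ring.
have /eqP/size_poly1P[d d0 D'E] := shift_difference_no_pole cop D'0 eqM'.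
have d0' : d%:P != 0 by rewrite polyC_eq0.
move: eqM'; rewrite D'E comp_polyC; set B := A' \Po _ => eqM'.
have eqc : 'X^M * (A' - B) = c * d%:P.
  by apply: (mulIf d0'); apply: etrans (etrans eqM' _); ring.
apply/eqP; apply: contraT => c0.
have : 'X^M * (A' - B) != 0 by rewrite eqc mulf_neq0.
rewrite mulf_eq0 negb_or => /andP[_ B0].
have szXB : size ('X^M * (A' - B)) = (M + size (A' - B)%R)%N.
  by rewrite size_monicM ?monicXn // size_polyXn.
have : size (c * d%:P) = size c by rewrite mulrC mul_polyC size_scale.
rewrite -eqc szXB => szc'; move: szc.
by rewrite -szc' -[X in (_ <= X)%N]addn0 leq_add2l leqn0 size_poly_eq0 (negPf B0).
Qed.

(** * Relations between sequences obeying the shift recurrence *)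

Section ShiftRecurrence.
Variables (K : numClosedFieldType) (u : seq nat -> nat -> K).
Variables (adm : pred (seq nat)).
Hypothesis adm_pos : forall s k, adm (rcons s k) -> (0 < k)%N.
Hypothesis u_nil : forall n, u [::] n = 1.
Hypothesis u_rcons : forall s k n, adm (rcons s k) -> (0 < n)%N ->
  u (rcons s k) n = u (rcons s k) n.+1 + (n.+1%:R ^+ k)^-1 * u s n.+1.

Notation sh p := (p \Po ('X - 1)).

Implicit Types (J : seq (seq nat)) (P : seq nat -> {poly K}).

(** The default [0] of [last] never produces a child, since [rcons t _] is not empty. *)
Definition child_of (t s : seq nat) := s == rcons t (last 0%N s).

Lemma child_of_rcons t s k : child_of t (rcons s k) = (t == s).
Proof. by rewrite /child_of last_rcons eqseq_rcons eqxx andbT eq_sym. Qed.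

Lemma child_of_nil t : child_of t [::] = false.
Proof. by case: t. Qed.

Lemma child_of_size t s : child_of t s -> size s = (size t).+1.
Proof. by move=> /eqP->; rewrite size_rcons. Qed.

(* With [w = n + 1], the relation at [n] expanded on the [u s w] by [u_rcons] and
   multiplied by [D(w)], minus the relation at [w] multiplied by [D(w - 1)]; the
   factor ['X^M] clears the negative powers of [w]. *)
Definition cross_coef J P (M : nat) (D : {poly K}) (t : seq nat) : {poly K} :=
  'X^M * sh (P t) * D
  + (\sum_(s <- J | child_of t s) 'X^(M - last 0%N s) * sh (P s)) * D
  - 'X^M * P t * sh D.

Definition relation J P :=
  exists N, forall n, (N <= n)%N -> \sum_(s <- J) (P s).[n%:R] * u s n = 0.

Definition prefix_closed J := forall s k, rcons s k \in J -> s \in J.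

(** By the recurrence each [s] contributes to [u s] and to [u] at its parent, which lies in [J] by
    prefix closure; exchanging the two sums collects at [t] the contributions of its children. *)
Lemma relation_cross J P M D : uniq J -> all adm J -> prefix_closed J ->
  (forall s, s \in J -> (last 0 s <= M)%N) ->
  relation J P -> relation J (cross_coef J P M D).
Proof.
(* The relation is used at [n] and [n + 1], and the recurrence at [n] needs [n > 0]; the new
   relation is read at [n + 1], hence the successor. *)
move=> uJ aJ cJ bJ [N PN]; exists (maxn N 1).+1 => -[//|n].
rewrite ltnS geq_max => /andP[Nn n0].
set w : K := n.+1%:R.
have w0 : w != 0 by rewrite pnatr_eq0.
have sh_w p : (sh p).[w] = p.[n%:R].
  by rewrite horner_comp !hornerE /w -natr1 addrK.
transitivity (D.[w] * \sum_(t <- J) (w ^+ M * (P t).[n%:R] * u t n.+1 +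
     \sum_(s <- J | child_of t s) w ^+ (M - last 0 s) * (P s).[n%:R] * u t n.+1)
   - w ^+ M * D.[n%:R] * \sum_(t <- J) (P t).[w] * u t n.+1).
  rewrite !big_distrr -sumrB; apply: eq_bigr => t _ /=.
  have -> : (cross_coef J P M D t).[w] = w ^+ M * (P t).[n%:R] * D.[w] +
      (\sum_(s <- J | child_of t s) w ^+ (M - last 0%N s) * (P s).[n%:R]) * D.[w]
      - w ^+ M * (P t).[w] * D.[n%:R].
    rewrite /cross_coef hornerD hornerN hornerD !hornerM !hornerXn !sh_w horner_sum.
    congr (_ + _ * _ - _); apply: eq_bigr => s _.
    by rewrite hornerM hornerXn sh_w.
  by rewrite -!mulr_suml; ring.
rewrite (PN n.+1) 1?leqW // mulr0 subr0 big_split /=.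
rewrite (exchange_big_dep xpredT) //= -big_split /=.
suff -> : \sum_(s <- J) (w ^+ M * (P s).[n%:R] * u s n.+1 +
    \sum_(t <- J | child_of t s) w ^+ (M - last 0 s) * (P s).[n%:R] * u t n.+1)
  = w ^+ M * \sum_(s <- J) (P s).[n%:R] * u s n by rewrite PN // !mulr0.
rewrite big_distrr /=; apply: eq_big_seq => s sJ.
case/lastP: s sJ => [|s k] sJ.
  rewrite big_pred0 => [|t]; last exact: child_of_nil.
  by rewrite !u_nil addr0 mulrA.
under eq_bigl do rewrite child_of_rcons.
rewrite -big_filter filter_pred1_uniq ?(cJ _ _ sJ) // big_seq1 last_rcons.
rewrite (@u_rcons s k n) ?(allP aJ) // -/w.
have := bJ _ sJ; rewrite last_rcons => kM.
have -> : w ^+ M = w ^+ (M - k) * w ^+ k by rewrite -exprD subnK.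
by field; rewrite expf_neq0.
Qed.

Lemma relation_eq0 J P : uniq J -> all adm J -> prefix_closed J ->
  sorted (relpre size leq) J -> relation J P -> forall s, s \in J -> P s = 0.
Proof.
elim/last_ind: J P => [//|J s0 IH] P uJ aJ cJ sJ relP.
have maxs0 s : s \in rcons J s0 -> (size s <= size s0)%N.
  move: sJ; rewrite sorted_pairwise; last first.
    by move=> x y z /=; exact: leq_trans.
  rewrite pairwise_rcons => /andP[/allP h _].
  by rewrite mem_rcons in_cons => /orP[/eqP->|/h].
have nochild t s : size t = size s0 -> s \in rcons J s0 -> child_of t s = false.
  move=> st /maxs0; apply: contraTF => /child_of_size ->.
  by rewrite st ltnn.
move: (uJ); rewrite rcons_uniq => /andP[s0J uJ0].
move: (aJ); rewrite all_rcons => /andP[as0 aJ0].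
have cJ0 : prefix_closed J.
  move=> s k skJ; have skJ' : rcons s k \in rcons J s0.
    by rewrite mem_rcons in_cons skJ orbT.
  have := cJ _ _ skJ'; rewrite mem_rcons in_cons => /predU1P[ss0|//].
  by have := maxs0 _ skJ'; rewrite size_rcons ss0 ltnn.
have sJ0 : sorted (relpre size leq) J.
  by move: sJ; rewrite -cats1 => /cat_sorted2[].
have IHr Q : relation (rcons J s0) Q -> Q s0 = 0 -> forall s, s \in J -> Q s = 0.
  move=> [N QN] Q0; apply: IH => //; exists N => n /QN.
  by rewrite big_rcons /= Q0 horner0 mul0r addr0.
have [Ps0|D0] := eqVneq (P s0) 0.
  by move=> s; rewrite mem_rcons in_cons => /predU1P[->//|]; apply: IHr.
exfalso; case/lastP: s0 => [|t k] in uJ aJ cJ sJ relP maxs0 nochild s0J as0 IHr D0 *.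
  (* If the longest index is empty there is no other one, and the relation says that [P [::]]
     vanishes at all large integers. *)
  have J0 : J = [::].
    case: J {IH uJ aJ cJ sJ relP nochild uJ0 aJ0 cJ0 sJ0 IHr} s0J maxs0 => // s J.
    move=> s0J /(_ s); rewrite rcons_cons in_cons eqxx => /(_ isT).
    by rewrite leqn0 size_eq0 => /eqP se; move: s0J; rewrite se in_cons.
  case: relP => N; rewrite J0 => PN.
  suff /eqP : P [::] = 0 by rewrite (negPf D0).
  by apply: (@poly_eventually0 _ _ N) => n /PN; rewrite big_seq1 u_nil mulr1.
set J1 := rcons J (rcons t k) in uJ aJ cJ sJ relP maxs0 nochild IHr *.
set D := P (rcons t k) in D0 *.
pose M := \max_(s <- J1) last 0%N s.
have bJ s : s \in J1 -> (last 0 s <= M)%N by move=> sJ1; apply: leq_bigmax_seq.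
have s0J1 : rcons t k \in J1 by rewrite mem_rcons mem_head.
have := relation_cross D uJ aJ cJ bJ relP => /IHr crossE.
(* Indices of maximal length have no child in [J1], so their cross coefficients reduce to a two-term
   shift equation. *)
have nosum s : size s = size (rcons t k) ->
    \sum_(s' <- J1 | child_of s s') 'X^(M - last 0%N s') * sh (P s') = 0.
  move=> ss; rewrite big_seq_cond big_pred0 // => s'.
  by apply/negP => /andP[/(nochild _ _ ss) ->].
have {}crossE s : s \in J1 -> cross_coef J1 P M D s = 0.
  have cr0 : cross_coef J1 P M D (rcons t k) = 0.
    by rewrite /cross_coef nosum // mul0r addr0 -/D; ring.
  by rewrite mem_rcons in_cons => /predU1P[->//|]; apply: crossE.
pose c s := lead_coef (P s) / lead_coef D.
have topE s : s \in J1 -> size s = size (rcons t k) -> P s = c s *: D.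
  move=> sJ1 ss; apply: shift_invariant_ratio => //.
  have := crossE s sJ1; rewrite /cross_coef nosum // mul0r addr0 => /eqP.
  rewrite subr_eq0 -!mulrA => /eqP /mulfI; apply.
  by rewrite monic_neq0 ?monicXn.
(* With [G = P t / D], the vanishing cross coefficient at [t] reads [G(z) - G(z-1) = C(z) / z^M]. *)
pose C := \sum_(s <- J1 | child_of t s) c s *: 'X^(M - last 0%N s).
suff : C = 0.
  (* Among the children of [t] only [rcons t k] contributes in degree [M - k], and its constant is
     [lead_coef D / lead_coef D = 1]. *)
  move/(congr1 (fun p : {poly K} => p`_(M - k))); rewrite coef0 => /eqP.
  rewrite /C coef_sum big_mkcond (bigD1_seq (rcons t k)) //= big1_seq.
    rewrite child_of_rcons eqxx addr0 coefZ coefXn last_rcons eqxx mulr1 /c.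
    by rewrite divff ?oner_eq0 ?lead_coef_eq0.
  move=> s /andP[sk sJ1]; case: ifP => // /eqP sE.
  have kM := bJ _ s0J1; have lM := bJ _ sJ1; rewrite last_rcons in kM.
  rewrite coefZ coefXn; case: eqP => [e|_]; last by rewrite mulr0.
  move: sk; rewrite {1}sE; suff -> : last 0%N s = k by rewrite eqxx.
  by rewrite -(subKn lM) -e subKn.
apply: (@shift_difference_eq0 _ (P t) D C M) => //.
  apply: leq_trans (size_sum _ _ _) _; apply/bigmax_leqP_seq => s sJ1 /eqP sE.
  apply: leq_trans (size_scale_leq _ _) _; rewrite size_polyXn.
  (* Positivity of the last entries puts every term of [C] in degree below [M]. *)
  have l0 : (0 < last 0%N s)%N by apply: (@adm_pos t); rewrite -sE (allP aJ).
  by rewrite -subSn ?bJ // leq_subLR -[M.+1]add1n leq_add2r.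
have := crossE t (cJ _ _ s0J1); rewrite /cross_coef.
(* Children of [t] have maximal length, so their coefficients are constant multiples of [D]. *)
have -> : \sum_(s <- J1 | child_of t s) 'X^(M - last 0%N s) * sh (P s) = C * sh D.
  rewrite mulr_suml big_seq_cond [RHS]big_seq_cond.
  apply: eq_bigr => s /andP[sJ1 cs].
  rewrite topE // ?comp_polyZ -?scalerAr -?scalerAl //.
  by rewrite (child_of_size cs) size_rcons.
move=> /eqP; rewrite subr_eq0 => /eqP e.
rewrite mulrBr !mulrA -e; ring.
Qed.
End ShiftRecurrence.

(** * Truncated sums and their finite recurrence *)

Fixpoint He_rec (K : fieldType) (z : K) (s : seq nat) (b : nat) : K :=
  if s is k :: s' then
    \sum_(1 <= n < b) ((n%:R + z) ^+ k)^-1 * He_rec z s' n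
  else 1.

(** The chain bound [b] is separate from the range [M] of the entries: peeling off the largest index
    makes it the new bound, while [M] stays fixed. *)
Lemma He_path_sumE (K : numFieldType) (z : K) (s : seq nat) (M b : nat) :
  (0 < b <= M)%N ->
  \sum_(n : (size s).-tuple 'I_M | path gtn b (rcons (map val n) 0%N))
    \prod_(i < size s) (((tnth n i)%:R + z) ^+ nth 0%N s i)^-1 = He_rec z s b.
Proof.
elim: s b => [|k s IH] b /andP[b0 bM] /=.
  rewrite (big_pred1 [tuple]) => [|n]; first by rewrite big_ord0.
  by rewrite [n]tuple0 /= b0 eqxx.
pose h (p : 'I_M * (size s).-tuple 'I_M) := [tuple of p.1 :: p.2].
have hbij : bijective h.
  exists (fun t : (size s).+1.-tuple 'I_M => (thead t, [tuple of behead t])).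
    by move=> [x t]; congr pair; apply: val_inj.
  by move=> t; rewrite [RHS]tuple_eta; apply: val_inj.
rewrite (reindex h) /=; last exact: onW_bij.
(* The value [0] at [n = 0] is that of an empty sum: no strictly decreasing chain goes from [0] to a
   final [0]. *)
pose G n : K := if n == 0%N then 0 else ((n%:R + z) ^+ k)^-1 * He_rec z s n.
transitivity (\sum_(i < M | (i < b)%N) G i).
  rewrite -(pair_big_dep (fun i : 'I_M => (i < b)%N)
    (fun i (t : (size s).-tuple 'I_M) => path gtn i (rcons (map val t) 0%N))
    (fun i t => \prod_(j < (size s).+1)
       (((tnth (h (i, t)) j)%:R + z) ^+ nth 0%N (k :: s) j)^-1)) /=.
  apply: eq_bigr => i ib; rewrite /G; case: (posnP i) => [i0|i0].
    by rewrite big_pred0 // i0 => t; case: (map _ _).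
  rewrite -IH ?i0 ?(ltnW (ltn_ord i)) // big_distrr /=.
  apply: eq_bigr => t _; rewrite big_ord_recl /= tnth0; congr (_ * _).
  by apply: eq_bigr => j _; rewrite tnthS.
rewrite -(big_mkord (fun i => (i < b)%N) G) -(big_nat_widen 0 b M xpredT) //.
rewrite big_ltn // {1}/G eqxx add0r; apply: eq_big_nat => i /andP[i0 _].
by rewrite /G gtn_eqF.
Qed.

Lemma He_truncE (K : numFieldType) (z : K) (s : seq nat) (N : nat) :
  (0 < N)%N -> He_trunc s z N = He_rec z s N.
Proof.
move=> N0; rewrite -(@He_path_sumE _ z s N) ?N0 /=; last by [].
apply: eq_bigl => n; case: (tval n) => [|x l] /=; first by rewrite N0.
by rewrite ltn_ord.
Qed.

Lemma He_rec_rcons1 (K : fieldType) (z : K) s k : He_rec z (rcons s k) 1 = 0.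
Proof. by case: s => [|? ?] /=; rewrite big_geq. Qed.

(** Terms with smallest index [1] give the second summand, the others the first; lowering the
    remaining indices by one turns [z] into [z + 1]. The bound starts at [2] so that the index [1]
    is present. *)
Lemma He_rec_rcons (K : fieldType) (z : K) s k b :
  He_rec z (rcons s k) b.+2 =
    He_rec (z + 1) (rcons s k) b.+1
    + ((z + 1) ^+ k)^-1 * He_rec (z + 1) s b.+1.
Proof.
have nS n : n.+1%:R + z = n%:R + (z + 1) by rewrite -natr1 -addrA [1 + z]addrC.
elim: s b => [|k0 s IH] b /=.
  rewrite big_nat_recl // addrC !mulr1 [1%:R + z]addrC; congr (_ + _).
  by apply: eq_big_nat => n _; rewrite nS.
rewrite big_ltn // He_rec_rcons1 mulr0 add0r big_distrr -big_split big_add1 /=.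
apply: eq_big_nat => -[//|n] _; rewrite IH nS; ring.
Qed.

Lemma He_rec_rmorph (K L : fieldType) (f : {rmorphism K -> L}) z s b :
  He_rec (f z) s b = f (He_rec z s b).
Proof.
elim: s b => [|k s IH] b /=; first by rewrite rmorph1.
rewrite rmorph_sum; apply: eq_bigr => n _.
by rewrite IH rmorphM fmorphV rmorphXn rmorphD rmorph_nat.
Qed.

(** * Convergence and recurrence at positive integers *)

Section NatPoints.
Variable R : realType.
Implicit Types (s : seq nat) (m b : nat).

Lemma He_rec_ge0 m s b : 0 <= He_rec (m%:R : R) s b.
Proof.
elim: s b => [|k s IH] b //=; apply: sumr_ge0 => n _.
by rewrite mulr_ge0 // invr_ge0 exprn_ge0 // addr_ge0.
Qed.

Lemma He_rec_homo m s :
  {homo He_rec (m%:R : R) s : b c / (b <= c)%N >-> b <= c}.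
Proof.
apply: homo_leq => [//||b]; first exact: le_trans.
case: s b => [//|k s] [|b] /=; first by rewrite !big_geq.
by rewrite [leRHS]big_nat_recr //= lerDl mulr_ge0 ?He_rec_ge0 //.
Qed.

Lemma admissible_rcons s k : admissible (rcons s k) ->
  [/\ admissible s, (0 < k)%N & s = [::] -> (1 < k)%N].
Proof.
rewrite /admissible all_rcons => /andP[/andP[k0 sp] hd].
by split; rewrite ?sp //; [case: s sp hd|move=> s0; rewrite s0 in hd].
Qed.

(* Telescoping [1/(m+1) + 1/(m+1)^2 <= 1/m] along the recurrence: an inner sum
   over a nonempty tail is itself at most [1/(m+1)]. *)
Lemma He_rec_le m s b : (0 < m)%N -> admissible s -> s != [::] ->
  He_rec (m%:R : R) s b.+1 <= m%:R^-1.
Proof.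
elim: b m s => [|b IH] m s m0; case/lastP: s => [//|s k] /[dup] ask.
  by rewrite He_rec_rcons1 invr_ge0.
move=> /admissible_rcons[as_ k0 k1] _; rewrite He_rec_rcons natr1.
have sk0 : rcons s k != [::] by case: s {ask as_ k1}.
have M0 : 0 < m%:R :> R by rewrite ltr0n.
have step : m.+1%:R^-1 + (m.+1%:R ^+ 2)^-1 <= m%:R^-1 :> R.
  rewrite -natr1 -subr_ge0.
  have -> : m%:R^-1 - ((m%:R + 1)^-1 + ((m%:R + 1) ^+ 2)^-1) =
      (m%:R * (m%:R + 1) ^+ 2)^-1 :> R.
    by field; rewrite gt_eqF // gt_eqF // ltr_wpDl.
  by rewrite invr_ge0 mulr_ge0 ?exprn_ge0 ?addr_ge0.
apply: le_trans step; apply: lerD; first exact: IH.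
have e1 j : (1 <= j)%N -> (m.+1%:R ^+ j)^-1 <= m.+1%:R^-1 :> R.
  by move=> j0; rewrite lef_pV2 ?posrE ?exprn_gt0 ?ltr0n // ler_eXnr ?ler1n.
(* For empty [s] the square comes from admissibility: [k] is then the first exponent, so
   [k >= 2]. *)
have [s0|s0] := eqVneq s [::].
  rewrite s0 /= mulr1 lef_pV2 ?posrE ?exprn_gt0 ?ltr0n //.
  by rewrite ler_weXn2l ?ler1n ?k1.
by rewrite expr2 invfM ler_pM ?invr_ge0 ?exprn_ge0 ?He_rec_ge0 ?e1 ?IH.
Qed.

Lemma He_rec_cvg m s : (0 < m)%N -> admissible s ->
  cvgn (He_rec (m%:R : R) s).
Proof.
move=> m0 as_; case: (eqVneq s [::]) => [->|s0]; first exact: is_cvg_cst.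
apply: nondecreasing_is_cvgn; first exact: He_rec_homo.
exists (m%:R^-1) => _ [b _ <-]; apply: le_trans (He_rec_le b m0 as_ s0).
exact: He_rec_homo.
Qed.

(** The limit is taken in [R], where monotone convergence applies; the embedding into [R[i]] comes
    afterwards. *)
Definition He_nat s m : R := limn (He_rec (m%:R : R) s).

Lemma cvg_He_nat_shift m s : (0 < m)%N -> admissible s ->
  (He_rec (m%:R : R) s n.+1 @[n --> \oo] --> He_nat s m)%classic.
Proof.
move=> m0 as_; rewrite (cvg_shiftS (He_rec (m%:R : R) s : nat -> R)).
exact: He_rec_cvg.
Qed.

Lemma He_nat_rcons s k m : admissible (rcons s k) -> (0 < m)%N ->
  He_nat (rcons s k) m =
    He_nat (rcons s k) m.+1 + (m.+1%:R ^+ k)^-1 * He_nat s m.+1.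
Proof.
move=> ask m0; have [as_ _ _] := admissible_rcons ask.
apply: cvg_lim => //; rewrite -(cvg_shiftn 2).
have -> : (fun n => He_rec (m%:R : R) (rcons s k) (n + 2)) =
   (fun n => He_rec (m.+1%:R : R) (rcons s k) n.+1 +
      (m.+1%:R ^+ k)^-1 * He_rec (m.+1%:R : R) s n.+1).
  by apply/funext => n; rewrite addn2 He_rec_rcons natr1.
by apply: cvgD; [|apply: cvgMr]; apply: cvg_He_nat_shift.
Qed.

Lemma cvg_real_complex (u : nat -> R) (l : R) :
  (u n @[n --> \oo] --> l)%classic ->
  (((u n)%:C%C : (R[i] : numFieldType)) @[n --> \oo] -->
     (l%:C%C : (R[i] : numFieldType)))%classic.
Proof.
move=> /cvgrPdist_lt ul; apply/cvgrPdist_lt => e e0.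
(* A positive element of [R[i]] is real, so the estimate can be read in [R]. *)
have eE : e = (complex.Re e)%:C%C.
  by move: e0; case: e => a b; rewrite ltcE /= => /andP[/eqP-> _].
have /ul : 0 < complex.Re e by move: e0; rewrite eE ltcR.
apply: filterS => n; rewrite eE -rmorphB normc_def /= expr0n addr0 sqrtr_sqr.
by rewrite ltcR.
Qed.

Lemma He_natE s m : (0 < m)%N -> admissible s ->
  He s (m%:R : R[i]) = (He_nat s m)%:C%C.
Proof.
move=> m0 as_; apply: cvg_lim; first exact: norm_hausdorff.
rewrite -cvg_shiftS.
have -> : (fun n => He_trunc s (m%:R : R[i]) n.+1) =
   (fun n => (He_rec (m%:R : R) s n.+1)%:C%C).
  by apply/funext => n; rewrite He_truncE // -He_rec_rmorph rmorph_nat.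
by apply: cvg_real_complex; apply: cvg_He_nat_shift.
Qed.

End NatPoints.

(** * Prefix closure of the index set and clearing of denominators *)

Definition prefixes (J : seq (seq nat)) : seq (seq nat) :=
  sort (relpre size leq)
    (undup [seq take l s | s <- J, l <- iota 0 (size s).+1]).

Lemma mem_prefixes J s :
  reflect (exists2 t, t \in J & prefix s t) (s \in prefixes J).
Proof.
rewrite mem_sort mem_undup; apply: (iffP allpairsPdep) => [[t [l [tJ _ ->]]]|].
  by exists t; rewrite ?prefix_take.
case=> t tJ /prefixP[r tE]; exists t, (size s); split=> //.
  by rewrite mem_iota add0n ltnS tE size_cat leq0n leq_addr.
by rewrite tE take_size_cat.
Qed.

Lemma prefixes_closed J : prefix_closed (prefixes J).
Proof.
move=> s k /mem_prefixes[t tJ skt]; apply/mem_prefixes; exists t => //.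
by apply: prefix_trans skt; exact: prefix_rcons.
Qed.

Lemma prefixes_sorted J : sorted (relpre size leq) (prefixes J).
Proof. by apply: sort_sorted => s t /=; exact: leq_total. Qed.

Lemma admissible_prefix s t : prefix s t -> admissible t -> admissible s.
Proof.
move=> /prefixP[r ->]; rewrite /admissible all_cat => /andP[/andP[-> _]].
by case: s.
Qed.

Lemma prefixes_admissible J :
  all admissible J -> all admissible (prefixes J).
Proof.
move=> /allP aJ; apply/allP => s /mem_prefixes[t tJ]; move=> /admissible_prefix.
by apply; exact: aJ.
Qed.

Theorem theorem1 (R : realType) :
  ratfun_lin_indep (He_domain (K := R[i]))
    (fun (s : He_index) (z : R[i]) => He (val s) z).
Proof.
move=> J F uJ rel i iJ.
pose u s n : R[i] := (He_nat R s n)%:C%C.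
(* A common denominator turns the rational coefficients into the polynomials [P j]. *)
pose Den := \prod_(j <- J) rf_den (F j).
pose P j := rf_num (F j) * (Den %/ rf_den (F j)).
(* Coefficients pass to bare sequences; a prefix that is no index of [J] gets the empty sum [0]. *)
pose Q s := \sum_(j <- J | val j == s) P j.
have denD j : j \in J -> Den %/ rf_den (F j) * rf_den (F j) = Den.
  by move=> jJ; rewrite divpK // /Den (big_rem j) //= dvdp_mulr.
have Den0 : Den != 0.
  by rewrite prodf_seq_neq0; apply/allP => j _; rewrite rf_den_neq0.
have quo0 j : j \in J -> Den %/ rf_den (F j) != 0.
  by move=> /denD e; apply: contraNneq Den0 => q0; rewrite -e q0 mul0r.
have uP s : s \in [seq val j | j <- J] -> s \in prefixes [seq val j | j <- J].
  by move=> sJ; apply/mem_prefixes; exists s; rewrite ?prefix_refl.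
have relQ : relation u (prefixes [seq val j | j <- J]) Q.
  have [N DenN] := poly_eventually_neq0 Den0.
  (* Beyond [N] no denominator vanishes, and [n >= 1] allows [He] to be replaced by its real
     value. *)
  exists (maxn N 1) => n; rewrite geq_max => /andP[/DenN Dn n0].
  transitivity (\sum_(j <- J) (P j).[n%:R] * u (val j) n).
    under eq_bigr => s _ do rewrite horner_sum mulr_suml.
    rewrite (exchange_big_dep xpredT) //=; apply: eq_big_seq => j jJ.
    under eq_bigl do rewrite eq_sym.
    rewrite -big_filter filter_pred1_uniq ?big_seq1 ?sort_uniq ?undup_uniq //.
    by apply: uP; exact: map_f.
  have denn j : j \in J -> (rf_den (F j)).[n%:R] != 0.
    move=> /denD e; move: Dn; rewrite -e hornerM mulf_eq0 negb_or.
    by case/andP.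
  have nD : He_domain (n%:R : R[i]).
    by move=> k; rewrite -subr_eq0 opprK -natrD pnatr_eq0 addn_eq0 gtn_eqF.
  have := congr1 ( *%R Den.[n%:R]) (rel _ nD denn); rewrite mulr0 big_distrr /=.
  move=> relDen; rewrite -[RHS]relDen; apply: eq_big_seq => j jJ.
  rewrite He_natE //; last exact: (valP j).
  rewrite mulrA; congr (_ * _); rewrite /rf_eval -(denD j jJ) !hornerM.
  by field; exact: denn.
have : Q (val i) = 0.
  apply: (@relation_eq0 _ u admissible _ _ _ _ Q _ _ _ _ relQ (val i))
    => [s k /admissible_rcons[]//|n|s k n ask n0|||||].
  - by rewrite /u /He_nat lim_cst.
  - by rewrite /u He_nat_rcons // rmorphD rmorphM fmorphV rmorphXn rmorph_nat.
  - by rewrite sort_uniq undup_uniq.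
  - by apply: prefixes_admissible; apply/allP => _ /mapP[j _ ->]; exact: (valP j).
  - exact: prefixes_closed.
  - exact: prefixes_sorted.
  - by apply: uP; exact: map_f.
(* As [val] is injective and [J] duplicate-free, only the term [P i] is left. *)
rewrite /Q; under eq_bigl do rewrite val_eqE.
rewrite -big_filter filter_pred1_uniq // big_seq1 => /eqP.
rewrite mulf_eq0 (negPf (quo0 i iJ)) orbF => /eqP num0.
by rewrite [F i]rf_numden num0 tofrac0 mul0r.
Qed.
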